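(* Let $H$ be a (real) Hilbert space, $G$ a group acting linearly and isometrically on $H$, and $\Sigma=H^G$ the subspace of symmetric elements (that is, $x\in\Sigma$ iff $gx=x$ for all $g\in G$). Let $f:H\to\mathbb R$ be a $G$-invariant $C^1$ function. Then: (i) If $x\in\Sigma$ is a critical point of $f_{|\Sigma}$, then $x$ is a critical point of $f$. (ii) If in addition $f$ is $C^2$, then $$D^2f(x)\cdot h\cdot k=0\quad\text{for all }h\in\Sigma,\ k\in\Sigma^\perp,$$ i.e. the orthogonal decomposition $H=\Sigma\oplus\Sigma^\perp$ is also orthogonal for the bilinear form $D^2f(x)$.
   Context: $G$-invariance of $f$ means $f(gx)=f(x)$ for all $g\in G$, $x\in H$. *)

(* Defs.v *)
From HB Require Import structures.
From mathcomp Require Import all_boot all_order all_algebra sesquilinear.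
From mathcomp Require Import all_classical all_reals all_analysis.

Set Implicit Arguments.
Unset Strict Implicit.
Unset Printing Implicit Defensive.

Import Order.TTheory GRing.Theory Num.Theory.
Import numFieldNormedType.Exports.

Local Open Scope classical_set_scope.
Local Open Scope ring_scope.

HB.mixin Record isHilbert (R : realType) H & CompleteNormedModule R H := {
  inner : {dot H for (@idfun R)} ;
  inner_normE : forall x : H, inner x x = `|x| ^+ 2
}.

#[short(type="hilbertType")]
HB.structure Definition Hilbert (R : realType) :=
  {H of CompleteNormedModule R H & isHilbert R H}.

Definition orthocomp (R : realType) (H : hilbertType R) (S : {pred H}) :
    {pred H} :=
  [pred k | `[< forall s, s \in S -> inner s k = 0 >]].

(* The space L(V, W) of continuous linear maps with the operator norm; C^1 and
   C^2 below refer to the topology of this norm. *)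
Section BoundedLinear.
Context {R : realType} {V W : normedModType R}.

Definition blin : {pred V -> W} := [pred f | `[< linear f /\ continuous f >]].

Lemma blin_submod_closed : submod_closed blin.
Proof.
split.
  apply/asboolP; split; first by move=> a x y /=; rewrite scaler0 addr0.
  by move=> x; exact: cvg_cst.
move=> c f g /asboolP[lf cf] /asboolP[lg cg]; apply/asboolP; split.
  move=> a x y; rewrite !fctE lf lg !scalerDr !scalerA (mulrC c a).
  by rewrite addrACA.
move=> x; apply: cvgD; last exact: cg.
by apply: cvgZl_tmp; exact: cf.
Qed.

HB.instance Definition _ := GRing.isSubmodClosed.Build R (V -> W) blin
  blin_submod_closed.

Record bounded_linear := BoundedLinear {
  blfun :> V -> W ;
  _ : blfun \in blin }.

HB.instance Definition _ := [isSub for blfun].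
HB.instance Definition _ := [Choice of bounded_linear by <:].
HB.instance Definition _ := [SubChoice_isSubLmodule of bounded_linear by <:].

Implicit Types f g : bounded_linear.

Definition op_norm f : R := sup [set `|f x| | x in [set x : V | `|x| <= 1]].

Lemma bl_linear f : linear f.
Proof. by have /asboolP[] := valP f. Qed.

Lemma bl_continuous f : continuous f.
Proof. by have /asboolP[] := valP f. Qed.

Lemma op_norm_has_sup f :
  has_sup [set `|f x| | x in [set x : V | `|x| <= 1]].
Proof.
pose F := HB.pack_for {linear V -> W} (blfun f)
  (GRing.isLinear.Build _ _ _ _ (blfun f) (bl_linear f)).
split; first by exists `|f 0|, 0 => //=; rewrite normr0.
have /linear_boundedP : bounded_near F (nbhs 0).
  by apply: continuous_linear_bounded; exact: bl_continuous.
move=> /pinfty_ex_gt0[M M0 HM]; exists M => _ [x /= x1 <-].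
by apply: (le_trans (HM x)); rewrite ler_piMr // ltW.
Qed.

Lemma op_norm_ub f x : `|x| <= 1 -> `|f x| <= op_norm f.
Proof.
by move=> x1; apply: (sup_upper_bound (op_norm_has_sup f)); exists x.
Qed.

Lemma op_norm_le f (M : R) :
  (forall x, `|x| <= 1 -> `|f x| <= M) -> op_norm f <= M.
Proof.
move=> fM; apply: ge_sup; first by case: (op_norm_has_sup f).
by move=> _ [x /= x1 <-]; exact: fM.
Qed.

Lemma op_normD f g : op_norm (f + g) <= op_norm f + op_norm g.
Proof.
apply: op_norm_le => x x1; apply: (le_trans (ler_normD _ _)).
by apply: lerD; exact: op_norm_ub.
Qed.

Lemma op_normZ (a : R) f : op_norm (a *: f) = `|a| * op_norm f.
Proof.
have le b g : op_norm (b *: g) <= `|b| * op_norm g.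
  apply: op_norm_le => x x1.
  rewrite [X in `|X|](_ : _ = b *: g x) // normrZ.
  by rewrite ler_wpM2l // op_norm_ub.
apply/eqP; rewrite eq_le le /=.
have [->|a0] := eqVneq a 0.
  rewrite normr0 mul0r; apply: (@le_trans _ _ `|(0 *: f : bounded_linear) 0|) => //.
  by apply: op_norm_ub; rewrite normr0.
rewrite -ler_pdivlMl ?normr_gt0 // -normfV.
by rewrite -[X in op_norm X <= _](scalerK a0) le.
Qed.

Lemma op_norm_eq0 f : op_norm f = 0 -> f = 0.
Proof.
move=> f0; apply: val_inj; apply/funext => x /=.
have [->|x0] := eqVneq x 0.
  by have := bl_linear f (-1) 0 0; rewrite scaleN1r !oppr0 addr0 scaleN1r addNr.
have nx0 : `|x| != 0 by rewrite normr_eq0.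
have : `|f (`|x|^-1 *: x)| <= 0.
  by rewrite -f0 op_norm_ub // normrZ normfV normr_id mulVf.
rewrite normr_le0 => /eqP fx.
have /= := bl_linear f `|x| (`|x|^-1 *: x) 0.
rewrite scalerA divff // scale1r addr0 fx scaler0 add0r => ->.
by have := bl_linear f (-1) 0 0; rewrite scaleN1r !oppr0 addr0 scaleN1r addNr.
Qed.

HB.instance Definition _ := Lmodule_isNormed.Build R bounded_linear
  op_normD op_normZ op_norm_eq0.

End BoundedLinear.
Arguments bounded_linear {R} V W.

Section Differentiability.
Context {R : realType}.

(* The value is the junk 0 when the linear map ['d f x] is not continuous,
   which never happens at a point of differentiability. *)
Definition fderiv (V W : normedModType R) (f : V -> W) (x : V) :
  bounded_linear V W := insubd 0 ('d f x : V -> W).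

Lemma fderivE (V W : normedModType R) (f : V -> W) (x : V) :
  differentiable f x -> fderiv f x = 'd f x :> (V -> W).
Proof.
move=> dfx; rewrite /fderiv -[LHS]/(val _) val_insubd ifT //.
by apply/asboolP; split; [exact: linearP|exact: diff_continuous].
Qed.

Definition C1 (V W : normedModType R) (f : V -> W) :=
  (forall x, differentiable f x) /\ continuous (fderiv f).

(* [fderiv (fderiv f) x h k] is D^2 f(x).h.k, with [fderiv f] valued in the
   normed space L(V, W). *)
Definition C2 (V W : normedModType R) (f : V -> W) := C1 f /\ C1 (fderiv f).

Definition critical_point (V : normedModType R) (f : V -> R) (x : V) :=
  differentiable f x /\ fderiv f x = 0.

End Differentiability.

Record isometric_action (G : groupType) (R : realType) (H : normedModType R) :=
  IsometricAction {
    act :> G -> {linear H -> H} ;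
    act1 : forall x, act 1%g x = x ;
    actM : forall g h x, act (g * h)%g x = act g (act h x) ;
    act_norm : forall g x, `|act g x| = `|x| }.

Section FixedSpace.
Context {G : groupType} {R : realType} {H : normedModType R}.
Variable a : isometric_action G H.

Definition fixed : {pred H} := [pred x | `[< forall g, a g x = x >]].

Lemma fixed_submod_closed : submod_closed fixed.
Proof.
split; first by apply/asboolP => g; rewrite linear0.
move=> c x y /asboolP fx /asboolP fy; apply/asboolP => g.
by rewrite linearP fx fy.
Qed.

HB.instance Definition _ := GRing.isSubmodClosed.Build R H fixed
  fixed_submod_closed.

(* The symmetric subspace as a normed space in its own right, so that critical
   points of a restriction f|Sigma are those of f \o fixed_val. *)
Record fixed_space := FixedSpace {
  fixed_val :> H ;
  _ : fixed_val \in fixed }.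

HB.instance Definition _ := [isSub for fixed_val].
HB.instance Definition _ := [Choice of fixed_space by <:].
HB.instance Definition _ := [SubChoice_isSubLmodule of fixed_space by <:].

Definition fixed_norm (x : fixed_space) : R := `|val x|.

Lemma fixed_normD x y : fixed_norm (x + y) <= fixed_norm x + fixed_norm y.
Proof. exact: ler_normD. Qed.

Lemma fixed_normZ (c : R) x : fixed_norm (c *: x) = `|c| * fixed_norm x.
Proof. exact: normrZ. Qed.

Lemma fixed_norm_eq0 x : fixed_norm x = 0 -> x = 0.
Proof. by move=> /normr0_eq0 x0; exact: val_inj. Qed.

HB.instance Definition _ := Lmodule_isNormed.Build R fixed_space
  fixed_normD fixed_normZ fixed_norm_eq0.

End FixedSpace.

(* Main.v *)
Require Import Defs.
From mathcomp Require Import all_boot all_order all_algebra sesquilinear.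
From mathcomp Require Import all_classical all_reals all_analysis.
From mathcomp Require Import ring lra.
Import Order.TTheory GRing.Theory Num.Theory.
Import numFieldNormedType.Exports.
Local Open Scope classical_set_scope.
Local Open Scope ring_scope.

(** The gradient of an invariant function at a symmetric point is itself
symmetric. Differentiating [f (a g y) = f y] at a fixed point shows that the
differential is an invariant functional ([fderiv_invariant]), and its Riesz
representative [v] is then a fixed vector
([invariant_functional_representative]).

Both claims follow. If the differential vanishes on the symmetric subspace, it
vanishes at [v], where its value is the squared norm of [v]; so [v = 0] and the
point is critical. If [k] is orthogonal to the symmetric subspace, then
[fderiv f y k = inner v k = 0] for every symmetric [y]; differentiating this
identity along a symmetric direction [h] gives the orthogonality for the second
derivative ([fderiv_eval_eq0]).

Riesz representation and the invariance of [v] are obtained together, from the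
quadratic energy [`|x| ^+ 2 / 2 - phi x]. Its minimizer exists by completeness,
represents [phi] by the first-order condition, and is unique by the
parallelogram identity. As the action preserves the energy, it must fix the
minimizer. *)

Lemma op_norm_bound {R : realType} {V W : normedModType R}
    (f : bounded_linear V W) (x : V) :
  `|f x| <= op_norm f * `|x|.
Proof.
have lf := bl_linear f.
have f0 : f 0 = 0.
  by have := lf (-1) 0 0; rewrite scaler0 addr0 scaleN1r addNr.
have [->|x0] := eqVneq x 0; first by rewrite f0 !normr0 mulr0.
have := op_norm_ub f (x := `|x|^-1 *: x).
rewrite normrZ normfV normr_id mulVf ?normr_eq0// => /(_ (lexx _)).
have := lf `|x|^-1 x 0; rewrite !addr0 f0 addr0 => ->.
by rewrite normrZ normfV normr_id ler_pdivrMl ?normr_gt0// mulrC.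
Qed.

Section Energy.
Context {R : realType} {H : hilbertType R}.
Variable phi : bounded_linear H R.

Let phiE (c : R) (x y : H) : phi (c *: x + y) = c * phi x + phi y.
Proof. exact: bl_linear. Qed.

Definition energy (x : H) : R := `|x| ^+ 2 / 2 - phi x.

Lemma energy_expansion (x y : H) (t : R) :
  energy (x + t *: y) =
  energy x + t * (inner x y - phi y) + t ^+ 2 * `|y| ^+ 2 / 2.
Proof.
rewrite /energy [in phi _]addrC phiE -!inner_normE.
rewrite linearDl !linearDr !(linearZl_LR (@inner R H)) !(linearZr_LR (@inner R H)) /=.
by rewrite (hermC _ y x) expr0 mul1r /=; field.
Qed.

(** The parallelogram identity, read as strong convexity: near-minimizers of
the energy are close to each other. *)
Lemma energy_midpoint (x y : H) :
  energy x + energy y - energy (2^-1 *: (x + y)) *+ 2 = `|x - y| ^+ 2 / 4.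
Proof.
pose d := x - y.
have -> : 2^-1 *: (x + y) = y + 2^-1 *: d.
  rewrite /d !scalerDr scalerN addrCA; congr (_ + _).
  apply/eqP; rewrite eq_sym subr_eq -scalerDl.
  by rewrite (_ : 2^-1 + 2^-1 = 1) ?scale1r//; field.
have -> : x = y + 1 *: d by rewrite scale1r /d addrC subrK.
rewrite !energy_expansion (_ : y + 1 *: d - y = d); first by field.
by rewrite scale1r addrC addrA addNr add0r.
Qed.

Lemma energy_bounded_below (x : H) : - (op_norm phi ^+ 2 / 2) <= energy x.
Proof.
have h := le_trans (ler_norm _) (op_norm_bound phi x).
have := sqr_ge0 (op_norm phi - `|x|).
rewrite /energy; nra.
Qed.

(** By [energy_midpoint] a minimizing sequence is Cauchy; the energy is
continuous, so the limit attains the infimum. *)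
Lemma energy_has_minimizer : exists v, forall x, energy v <= energy x.
Proof.
pose m := inf (range energy).
have hinf : has_inf (range energy).
  split; first by exists (energy 0), 0.
  by exists (- (op_norm phi ^+ 2 / 2)) => _ [x _ <-]; exact: energy_bounded_below.
have mle x : m <= energy x by apply: ge_inf; [case: hinf|exists x].
have /choice[u uE] : forall n : nat, exists x, energy x < m + n.+1%:R^-1.
  move=> n; have n0 : 0 < n.+1%:R^-1 :> R by rewrite invr_gt0.
  by have [_ [x _ <-] hx] := inf_adherent n0 hinf; exists x.
have : cvg (u n @[n --> \oo]).
  apply/cauchy_cvgP/cauchy_ballP => e e0.
  have e1 : 0 < e ^+ 2 / 8 by rewrite divr_gt0// exprn_gt0.
  have small : \forall n \near \oo, energy (u n) < m + e ^+ 2 / 8.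
    near=> n; apply: (lt_trans (uE n)); rewrite ltrD2l.
    by near: n; exact: (near_infty_natSinv_lt (PosNum e1)).
  near=> x y; rewrite -ball_normE /=.
  rewrite -(@ltr_pXn2r _ 2) ?nnegrE// ?(ltW e0)//.
  have hx : energy x < m + e ^+ 2 / 8 by near: x; exact: small.
  have hy : energy y < m + e ^+ 2 / 8 by near: y; exact: small.
  have := energy_midpoint x y; have := mle (2^-1 *: (x + y)); lra.
move=> /cvg_ex[v uv]; exists v => x; apply: le_trans (mle x).
have Ju : energy (u n) @[n --> \oo] --> energy v.
  apply: cvgB.
    apply: cvgMr_tmp; rewrite expr2; apply: cvgM; exact: cvg_norm.
  by apply: continuous_cvg => //; exact: bl_continuous.
apply/ler_addgt0Pr => e e0; apply: (cvgr_to_le Ju).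
near=> n; apply: ltW; apply: (lt_trans (uE n)); rewrite ltrD2l.
by near: n; exact: (near_infty_natSinv_lt (PosNum e0)).
Unshelve. all: by end_near.
Qed.

(** [inner v y - phi y] is the derivative of the energy at its minimizer [v]
along [y], hence zero. *)
Lemma riesz_minimizer (v : H) :
  (forall x, energy v <= energy x) -> forall y, phi y = inner v y.
Proof.
move=> vmin y; pose c := inner v y - phi y; pose b := `|y| ^+ 2 / 2.
have b0 : 0 <= b by rewrite divr_ge0// exprn_ge0.
(* This step decreases the energy by exactly [(c / (b + 1)) ^+ 2]; the exact
   minimizer along [y] would need a separate treatment of [y = 0]. *)
have := vmin (v + (- c / (b + 1)) *: y).
rewrite energy_expansion -/c.
have -> : energy v + - c / (b + 1) * c + (- c / (b + 1)) ^+ 2 * `|y| ^+ 2 / 2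
   = energy v - (c / (b + 1)) ^+ 2.
  by rewrite -[_ * _ / 2]mulrA -/b; field; rewrite lt0r_neq0// ltr_wpDl.
rewrite lerBrDr gerDl => c0; have /eqP : (c / (b + 1)) ^+ 2 == 0.
  by rewrite eq_le c0 sqr_ge0.
move=> /eqP; rewrite sqrf_eq0 mulf_eq0 invr_eq0 => /orP[|/eqP]; last lra.
by rewrite subr_eq0 => /eqP ->.
Qed.

Lemma energy_minimizer_unique (v w : H) :
  (forall x, energy v <= energy x) -> energy w = energy v -> w = v.
Proof.
move=> vmin wv; have := energy_midpoint w v; rewrite wv.
have := vmin (2^-1 *: (w + v)) => h1 h2.
have : `|w - v| ^+ 2 <= 0 by lra.
rewrite le_eqVlt ltNge sqr_ge0 orbF sqrf_eq0 normr_eq0 subr_eq0.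
by move=> /eqP.
Qed.

End Energy.

(** The action preserves the norm and [phi], hence the energy, so each
[a g] maps the minimizer to a minimizer, that is, to itself. *)
Lemma invariant_functional_representative {R : realType} {H : hilbertType R}
    {G : groupType} {a : isometric_action G H} (phi : bounded_linear H R) :
  (forall g x, phi (a g x) = phi x) ->
  exists2 v, v \in fixed a & forall y, phi y = inner v y.
Proof.
move=> phiG; have [v vmin] := energy_has_minimizer phi.
exists v; last exact: riesz_minimizer.
apply/asboolP => g; apply: (energy_minimizer_unique phi v) => //.
by rewrite /energy act_norm phiG.
Qed.

(** For [x] fixed, [t *: a g y + x = a g (t *: y + x)], so the difference
quotients of [f] at [x] along [a g y] and along [y] coincide. *)
Lemma fderiv_invariant {R : realType} {H : normedModType R} {G : groupType}
    {a : isometric_action G H} (f : H -> R) (x : H) :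
  (forall g y, f (a g y) = f y) -> differentiable f x -> x \in fixed a ->
  forall g y, fderiv f x (a g y) = fderiv f x y.
Proof.
move=> fG dfx /asboolP xfix g y.
have quotientE : (fun t : R => t^-1 *: ((f \o shift x) (t *: a g y) - f x)) =
    (fun t : R => t^-1 *: ((f \o shift x) (t *: y) - f x)).
  by apply/funext => t /=; rewrite -(fG g (t *: y + x)) linearP xfix.
by rewrite (fderivE dfx) -!deriveE// /derive quotientE.
Qed.

Lemma fderiv_restriction {R : realType} {H : normedModType R} {G : groupType}
    {a : isometric_action G H} (f : H -> R) (x h : fixed_space a) :
  differentiable f (fixed_val x) ->
  differentiable (f \o @fixed_val G R H a) x ->
  fderiv (f \o @fixed_val G R H a) x h = fderiv f (fixed_val x) (fixed_val h).
Proof.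
move=> df dfr; rewrite (fderivE df) (fderivE dfr).
(* Both sides are limits of the same difference quotients, by conversion. *)
by rewrite -!deriveE.
Qed.

(** Needed to exchange evaluation at [k] with the operator-norm limit that
defines a second derivative. *)
Lemma bl_eval_continuous {R : realType} {V W : normedModType R} (k : V) :
  continuous (fun T : bounded_linear V W => T k).
Proof.
move=> T; apply/(@cvgrPdist_le _ _ _ (nbhs T)) => e e0; near=> S.
have -> : T k - S k = (T - S) k by [].
apply: (le_trans (op_norm_bound _ _)).
have : `|T - S| <= e / (`|k| + 1).
  near: S; apply: (@cvgr_dist_le _ _ _ (nbhs T) _ id T cvg_id).
  by rewrite divr_gt0// ltr_wpDl.
rewrite ler_pdivlMr ?ltr_wpDl// => /(le_trans _); apply.
apply: ler_wpM2l; last by rewrite lerDl.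
exact: (@normr_ge0 _ _ (T - S)).
Unshelve. all: by end_near.
Qed.

Lemma fderiv_eval_eq0 {R : realType} {U V W : normedModType R}
    (F : U -> bounded_linear V W) (x h : U) (k : V) :
  differentiable F x -> (forall t : R, F (t *: h + x) k = 0) ->
  fderiv F x h k = 0.
Proof.
move=> dF F0; rewrite (fderivE dF) -deriveE// /derive.
have Fx0 : F x k = 0 by have := F0 0; rewrite scale0r add0r.
have quotient0 :
    (fun t : R => (t^-1 *: ((F \o shift x) (t *: h) - F x)) k) = cst 0.
  apply/funext => t /=.
  by rewrite -[LHS]/(t^-1 *: (F (t *: h + x) k - F x k)) F0 Fx0 subrr scaler0.
set l := lim _.
have l0 : (cst 0 : R -> W) t @[t --> 0^'] --> l k.
  rewrite -quotient0.
  apply: (@continuous_cvg _ _ _ _ _ _ (fun T : bounded_linear V W => T k)).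
    exact: bl_eval_continuous.
  exact: (diff_derivable (v := h) dF).
by rewrite -(cvg_lim (@norm_hausdorff _ _) l0); exact: lim_cst.
Qed.

Theorem propositionA1 (R : realType) (H : hilbertType R) (G : groupType)
    (a : isometric_action G H) (f : H -> R)
    (f_invariant : forall (g : G) (x : H), f (a g x) = f x)
    (f_C1 : C1 f) :
  (forall x : fixed_space a,
     critical_point (f \o @fixed_val G R H a) x ->
     critical_point f (fixed_val x)) /\
  (C2 f ->
   forall x h k : H,
     x \in fixed a -> h \in fixed a -> k \in orthocomp (fixed a) ->
     fderiv (fderiv f) x h k = 0).
Proof.
have [df _] := f_C1.
have grad y : y \in fixed a ->
    exists2 v, v \in fixed a & forall k, fderiv f y k = inner v k.
  move=> yfix; apply: invariant_functional_representative.
  exact: fderiv_invariant.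
split=> [x [dfr fr0]|[_ [d2f _]] x h k xfix hfix /asboolP kperp].
  split=> //; have [v vfix vE] := grad _ (valP x).
  have : inner v v = 0.
    by rewrite -vE -(fderiv_restriction _ x (FixedSpace vfix)) ?fr0.
  rewrite inner_normE => /eqP; rewrite sqrf_eq0 normr_eq0 => /eqP v0.
  by apply/val_inj/funext => k /=; rewrite vE v0 linear0l.
apply: fderiv_eval_eq0 => // t.
have [|v vfix ->] := grad (t *: h + x); last exact: kperp.
by rewrite rpredD ?rpredZ.
Qed.
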